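(* Let $\Gamma\subset\mathrm{SO}(2,2)_\circ$ be a quasi-Fuchsian group, and consider the open set $$\widetilde{\mathcal M}=\{(x,v)\in T^1\mathrm{AdS}_3\,|\,\exists t\in\mathbb R,\ \pi(\varphi_t(x,v))\in\mathcal O_+(\Lambda_\Gamma)\}=\bigcup_{t\in\mathbb R}\varphi_t\big(T^1\mathcal O_+(\Lambda_\Gamma)\big).$$ The action of $\Gamma$ on $\widetilde{\mathcal M}$ is free and properly discontinuous.
   Context: $q(x,y)=-x_1y_1-x_2y_2+x_3y_3+x_4y_4$ on $\mathbb R^4$, $q(x)=q(x,x)$; $\mathrm{AdS}_3=\{q(x)=-1\}$ with Lorentzian metric induced by $q$, whose isometry group has identity component $\mathrm{SO}(2,2)_\circ$. $\partial\mathrm{AdS}_3=\{x\ne0:q(x)=0\}/\mathbb R^+$ is identified with $\mathbb T^2=\{\nu\in\mathbb R^4:\nu_1^2+\nu_2^2=\nu_3^2+\nu_4^2=1\}=\mathbb S^1\times\mathbb S^1$. An acausal circle is a set $\Lambda=\{(F(z),z):z\in\mathbb S^1\}\subset\mathbb T^2$ with $F:\mathbb S^1\to\mathbb S^1$, $|F(z)-F(z')|<|z-z'|$ for $z\ne z'$; $C(\Lambda)=\{x/\sqrt{|q(x)|}: x\in\mathrm{Conv}(\Lambda)\subset\mathbb R^4, q(x)<0\}$; $\mathcal O_+(\Lambda)=\{x\in\mathrm{AdS}_3: q(x,\nu)<0\ \forall\nu\in\Lambda\}$. A subgroup $\Gamma\subset\mathrm{SO}(2,2)_\circ$ is quasi-Fuchsian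 if it preserves an acausal circle $\Lambda_\Gamma$ (unique) and acts freely, properly discontinuously and co-compactly on $C(\Lambda_\Gamma)$. $T^1\mathrm{AdS}_3=\{(x,v): q(x)=-1,q(x,v)=0,q(v)=1\}$, $\pi(x,v)=x$, $\varphi_t(x,v)=(x\cosh t+v\sinh t,x\sinh t+v\cosh t)$ is the spacelike geodesic flow, $T^1\mathcal O_+(\Lambda_\Gamma)=\pi^{-1}(\mathcal O_+(\Lambda_\Gamma))$, and $h\in\mathrm{SO}(2,2)_\circ$ acts by $h(x,v)=(hx,hv)$. *)

(* Defs.v *)
From mathcomp Require Import all_boot all_order all_algebra.
From mathcomp Require Import all_classical all_reals all_analysis.

Set Implicit Arguments.
Unset Strict Implicit.
Unset Printing Implicit Defensive.

Import Order.TTheory GRing.Theory Num.Theory.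
Import numFieldNormedType.Exports.

Local Open Scope classical_set_scope.
Local Open Scope ring_scope.

(* Vectors are columns, so that matrices act on the left.  The informal
   coordinates x_1, ..., x_4 are the entries of index 0, ..., 3. *)

Section AdS.
Variable R : realType.

Local Notation V := 'cV[R]_4.
Local Notation E2 := 'cV[R]_2.
Local Notation M4 := 'M[R]_4.

Definition entry n (x : 'cV[R]_n.+1) (k : nat) : R := x (inord k) 0.

Definition qform (x y : V) : R :=
  - (entry x 0 * entry y 0) - entry x 1 * entry y 1
  + entry x 2 * entry y 2 + entry x 3 * entry y 3.

Definition AdS3 : set V := [set x | qform x x = -1].

Definition SO22 : set M4 :=
  [set g | \det g = 1 /\ forall x y : V, qform (g *m x) (g *m y) = qform x y].

Definition SO22o : set M4 := connected_component SO22 1%:M.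

Definition is_subgroup (G H : set M4) : Prop :=
  [/\ H `<=` G, H 1%:M,
      forall g h, H g -> H h -> H (g *m h) &
      forall g, H g -> H (invmx g)].

(* The norm that MathComp-Analysis puts on matrices is the sup norm, hence an
   explicit Euclidean norm for chord lengths in the circle. *)
Definition enorm2 (z : E2) : R := Num.sqrt (entry z 0 ^+ 2 + entry z 1 ^+ 2).

Definition circle : set E2 := [set z | enorm2 z = 1].

Definition acausal_circle (L : set V) : Prop :=
  exists F : E2 -> E2,
    [/\ forall z, circle z -> circle (F z),
        forall z z', circle z -> circle z' -> z <> z' ->
          enorm2 (F z - F z') < enorm2 (z - z') &
        L = [set (col_mx (F z) z : V) | z in circle]].

(* The point of T^2 on the ray spanned by a nonzero isotropic vector: there
   x_1^2 + x_2^2 = x_3^2 + x_4^2 > 0. *)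
Definition to_torus (x : V) : V :=
  (Num.sqrt (entry x 0 ^+ 2 + entry x 1 ^+ 2))^-1 *: x.

(* Action on the boundary of AdS_3, through its identification with T^2. *)
Definition bd_act (g : M4) (nu : V) : V := to_torus (g *m nu).

Definition preserves_bd (G : set M4) (L : set V) : Prop :=
  forall g, G g -> bd_act g @` L = L.

Definition conv_hull (A : set V) : set V :=
  smallest (fun B : set (convex_lmodType V) => convex_set B) A.

Definition convex_core (L : set V) : set V :=
  [set (Num.sqrt `|qform x x|)^-1 *: x |
    x in [set x | conv_hull L x /\ qform x x < 0]].

Definition O_plus (L : set V) : set V :=
  [set x | AdS3 x /\ forall nu, L nu -> qform x nu < 0].

Section Actions.
Variables (T : topologicalType) (act : M4 -> T -> T) (G : set M4) (X : set T).

Definition preserved : Prop := forall g, G g -> act g @` X = X.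

Definition acts_freely : Prop :=
  forall g x, G g -> X x -> act g x = x -> g = 1%:M.

Definition acts_properly_discontinuously : Prop :=
  forall K : set T, K `<=` X -> compact K ->
    finite_set [set g | G g /\ (act g @` K) `&` K !=set0].

Definition acts_cocompactly : Prop :=
  exists K : set T,
    [/\ K `<=` X, compact K & X `<=` \bigcup_(g in G) (act g @` K)].

End Actions.

Definition act_pt (g : M4) (x : V) : V := g *m x.

Definition act_tan (g : M4) (p : V * V) : V * V := (g *m p.1, g *m p.2).

(* [quasi_fuchsian G L]: G is quasi-Fuchsian and L is its (unique) acausal
   circle Lambda_G. *)
Definition quasi_fuchsian (G : set M4) (L : set V) : Prop :=
  [/\ is_subgroup SO22o G,
      acausal_circle L,
      preserves_bd G L &
      [/\ acts_freely act_pt G (convex_core L),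
          acts_properly_discontinuously act_pt G (convex_core L) &
          acts_cocompactly act_pt G (convex_core L)]].

Definition T1AdS3 : set (V * V) :=
  [set p | [/\ qform p.1 p.1 = -1, qform p.1 p.2 = 0 & qform p.2 p.2 = 1]].

Definition cosh (t : R) : R := (expR t + expR (- t)) / 2.
Definition sinh (t : R) : R := (expR t - expR (- t)) / 2.

Definition geod_flow (t : R) (p : V * V) : V * V :=
  (cosh t *: p.1 + sinh t *: p.2, sinh t *: p.1 + cosh t *: p.2).

Definition T1O_plus (L : set V) : set (V * V) :=
  [set p | T1AdS3 p /\ O_plus L p.1].

Definition Mtilde (L : set V) : set (V * V) :=
  [set p | T1AdS3 p /\ exists t : R, O_plus L (geod_flow t p).1].

End AdS.

(* Main.v *)
(* A point p of [Mtilde L], moved by the flow to a suitable time, has a base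
   point x with q(x, nu) < 0 on L, and the set of such times is G-invariant.
   Let p and g p both lie in a compact set, with uniformly bounded good times s
   and t.  Then u = phi_s(p) + phi_t(p) is bounded, while the form q(g u, .) is
   bounded away from 0 on L: it is negative at both times, and uniformly so at
   the time t, which is chosen for g p.  Fix y0 in C(L).  As
   q(g u, g y0) = q(u, y0) is bounded, writing g y0 = sum_(i < 4) a_i nu_i with
   nu_i in L (Caratheodory) bounds the a_i, so that g y0 stays in a fixed compact
   subset of C(L), and proper discontinuity on C(L) leaves finitely many g.  An
   element fixing a point of [Mtilde L] therefore has finite order; the sum of
   the orbit of y0 under its powers is timelike and fixed, and normalizes to a
   fixed point in C(L). *)
Require Import Defs.
From mathcomp Require Import all_boot all_order all_algebra.
From mathcomp Require Import all_classical all_reals all_analysis.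
From mathcomp Require Import ring lra.
Import Order.TTheory GRing.Theory Num.Theory.
Import numFieldNormedType.Exports.

Set Implicit Arguments.
Unset Strict Implicit.
Unset Printing Implicit Defensive.

Local Open Scope classical_set_scope.
Local Open Scope ring_scope.

(** * The form q, convex cones and Caratheodory's theorem *)

Section QForm.
Variable R : realType.
Local Notation V := 'cV[R]_4.
Implicit Types (x y z : V) (g : 'M[R]_4).

Lemma qformC x y : qform x y = qform y x.
Proof. by rewrite /qform; ring. Qed.

Lemma qformDl x y z : qform (x + y) z = qform x z + qform y z.
Proof. by rewrite /qform /entry !mxE; ring. Qed.

Lemma qformZl a x z : qform (a *: x) z = a * qform x z.
Proof. by rewrite /qform /entry !mxE; ring. Qed.

Lemma qformDr x y z : qform z (x + y) = qform z x + qform z y.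
Proof. by rewrite /qform /entry !mxE; ring. Qed.

Lemma qformZr a x z : qform z (a *: x) = a * qform z x.
Proof. by rewrite /qform /entry !mxE; ring. Qed.

Lemma qform0l x : qform 0 x = 0.
Proof. by rewrite /qform /entry !mxE; ring. Qed.

Lemma qform0r x : qform x 0 = 0.
Proof. by rewrite qformC qform0l. Qed.

Definition qformE := (qformDl, qformDr, qformZl, qformZr).

(** Finite nonnegative combinations, given inductively so that statements about them follow by
    adding one generator at a time. Points of C(L) are normalized by q, so only rays matter and the
    cone can replace the convex hull. *)
Inductive cone (A : set V) : V -> Prop :=
| cone_nil : cone A 0
| cone_cons a nu x : 0 <= a -> A nu -> cone A x -> cone A (a *: nu + x).

Lemma cone_gen (A : set V) nu : A nu -> cone A nu.
Proof.
move=> Anu; have := cone_cons ler01 Anu (cone_nil A).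
by rewrite scale1r addr0.
Qed.

Lemma cone_add (A : set V) x y : cone A x -> cone A y -> cone A (x + y).
Proof.
move=> + Ay; elim => [|a nu z a0 Anu _ IH]; first by rewrite add0r.
by rewrite -addrA; exact: cone_cons.
Qed.

Lemma cone_scale (A : set V) a x : 0 <= a -> cone A x -> cone A (a *: x).
Proof.
move=> a0; elim => [|b nu z b0 Anu _ IH].
  by rewrite scaler0; exact: cone_nil.
by rewrite scalerDr scalerA; apply: cone_cons => //; exact: mulr_ge0.
Qed.

Lemma cone_sum (A : set V) n (f : 'I_n -> V) :
  (forall i, cone A (f i)) -> cone A (\sum_i f i).
Proof.
move=> Af; elim/big_ind : _ => //; first exact: cone_nil.
exact: cone_add.
Qed.

Lemma conv_hull_convex (A : set V) x y s t : 0 <= s -> 0 <= t -> s + t = 1 ->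
  conv_hull A x -> conv_hull A y -> conv_hull A (s *: x + t *: y).
Proof.
move=> s0 t0 st Ax Ay B [cB AB].
have s1 : s <= 1 by lra.
have -> : t = 1 - s by lra.
apply/set_mem.
have [Bx By] := (mem_set (Ax B (conj cB AB)), mem_set (Ay B (conj cB AB))).
exact: (cB x y (Itv01 s0 s1) Bx By).
Qed.

Lemma conv_hull_cone (A : set V) : conv_hull A `<=` cone A.
Proof.
rewrite /conv_hull.
apply: (@smallest_sub (convex_lmodType V) _ A (cone A)); last first.
  by move=> x; apply: cone_gen.
move=> x y l.
rewrite !inE => Ax Ay.
by apply: cone_add; apply: cone_scale => //; rewrite subr_ge0; exact: le1.
Qed.

(** Dividing a nonzero combination by the sum of its coefficients makes it convex. The empty
    combination is why 0 is a separate case: the hull need not contain 0. *)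
Lemma cone_conv_hull (A : set V) x : cone A x ->
  x = 0 \/ exists s y, [/\ 0 < s, conv_hull A y & x = s *: y].
Proof.
elim => [|a nu z a0 Anu _]; first by left.
have hnu : conv_hull A nu by exact: sub_gen_smallest.
case: (ltgtP 0 a) a0 => // [a0|<-] _; last by rewrite scale0r add0r.
case=> [->|[s [y [s0 hy ->]]]]; right.
  by exists a, nu; rewrite addr0.
have sa : 0 < a + s by exact: addr_gt0.
exists (a + s), ((a / (a + s)) *: nu + (s / (a + s)) *: y); split => //.
  apply: conv_hull_convex => //; first by rewrite divr_ge0 // ltW.
    by rewrite divr_ge0 // ltW.
  by rewrite -mulrDl divff // gt_eqF.
by rewrite scalerDr !scalerA ![(a + s) * _]mulrC !divfK ?gt_eqF.
Qed.

(** The working description of C(L), free of square roots: the slice of the cone by the hyperboloid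
    q = -1. *)
Lemma convex_coreP (A : set V) x :
  convex_core A x <-> cone A x /\ qform x x = -1.
Proof.
split=> [[y [hy qy] <-]|[cx qx]].
  split; first by apply: cone_scale; [rewrite invr_ge0 sqrtr_ge0|exact: conv_hull_cone].
  have q0 : 0 < `|qform y y| by rewrite normr_gt0 lt_eqF.
  have s0 : Num.sqrt `|qform y y| != 0 by rewrite gt_eqF // sqrtr_gt0.
  rewrite !qformE mulrA -invfM -expr2 sqr_sqrtr ?ltW // ltr0_norm //.
  by rewrite invrN mulNr mulVf // lt_eqF.
have [x0|[s [y [s0 hy xE]]]] := cone_conv_hull cx.
  by move: qx; rewrite x0 qform0l => /eqP; rewrite eq_sym oppr_eq0 oner_eq0.
have qyE : qform y y = - (s ^+ 2)^-1.
  move: qx; rewrite xE !qformE mulrA -expr2 => /(congr1 (fun u => (s ^+ 2)^-1 * u)).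
  by rewrite mulKf ?mulrN1 // expf_neq0 // gt_eqF.
exists y.
  by split=> //; rewrite qyE oppr_lt0 invr_gt0 exprn_gt0.
rewrite qyE normrN normfV sqrtrV ?normr_ge0 // ger0_norm ?exprn_ge0 ?ltW //.
by rewrite sqrtr_sqr gtr0_norm // invrK xE.
Qed.

Lemma cone_qform_le (A : set V) w :
  (forall nu, A nu -> qform w nu <= 0) -> forall x, cone A x -> qform w x <= 0.
Proof.
move=> wA x; elim => [|a nu z a0 Anu _ IH]; first by rewrite qform0r.
by rewrite !qformE; have := mulr_ge0_le0 a0 (wA _ Anu); lra.
Qed.

(** The reduction step of Caratheodory's theorem: n + 1 vectors in dimension n satisfy a linear
    relation c, and subtracting a suitable multiple of c from a kills one coefficient while keeping
    the others nonnegative. *)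
Lemma nonneg_combination_drop n (a : 'I_n.+1 -> R) (v : 'I_n.+1 -> 'cV[R]_n) :
  (forall i, 0 <= a i) ->
  exists (i0 : 'I_n.+1) (b : 'I_n -> R), (forall i, 0 <= b i) /\
    \sum_i a i *: v i = \sum_(i < n) b i *: v (lift i0 i).
Proof.
move=> a0.
pose M : 'M[R]_(n.+1, n) := \matrix_(i, j) v i j 0.
have [c [c_gt0 cM]] : exists c : 'I_n.+1 -> R,
    (exists i, 0 < c i) /\ \sum_i c i *: v i = 0.
  have /rowV0Pn[u /sub_kermxP uM u0] : kermx M != 0.
    rewrite kermx_eq0 /row_free neq_ltn; apply/orP; left.
    by rewrite ltnS rank_leq_col.
  have uS : \sum_i u 0 i *: v i = 0.
    apply/colP => j; rewrite summxE mxE.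
    have /rowP/(_ j) := uM; rewrite !mxE => uMj; rewrite -[RHS]uMj.
    by apply: eq_bigr => i _; rewrite !mxE.
  have [i ui0] : exists i, u 0 i != 0.
    apply/existsP; apply: contra_neqT u0 => /existsPn ui.
    by apply/rowP => i; rewrite mxE; apply/eqP/negPn.
  (* A relation may be negated, so some coefficient can be taken positive. *)
  case: (ltgtP 0 (u 0 i)) ui0 => // ui _.
    by exists (u 0); split => //; exists i.
  exists (fun i => - u 0 i); split; first by exists i; rewrite oppr_gt0.
  under eq_bigr do rewrite scaleNr.
  by rewrite sumrN uS oppr0.
have [i1 ci1] := c_gt0.
(* The minimal ratio a_i / c_i over c_i > 0 is the largest multiple of c that can be subtracted;
   where c_i <= 0 the coefficient does not decrease. *)
have [i0 ci0 imin] := @arg_minP _ _ _ i1 (fun i => 0 < c i) (fun i => a i / c i) ci1.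
pose t := a i0 / c i0.
have t0 : 0 <= t by rewrite divr_ge0 // ltW.
exists i0, (fun i => a (lift i0 i) - t * c (lift i0 i)); split=> [i|].
  set j := lift i0 i; rewrite subr_ge0.
  have [cj|cj] := ltP 0 (c j); first by rewrite -ler_pdivlMr //; exact: imin.
  by apply: le_trans (a0 j); exact: mulr_ge0_le0.
transitivity (\sum_i (a i - t * c i) *: v i).
  under [RHS]eq_bigr do rewrite scalerBl -scalerA.
  by rewrite sumrB -scaler_sumr cM scaler0 subr0.
rewrite (bigD1_ord i0) //= /t divfK ?gt_eqF // subrr scale0r add0r //.
Qed.

Lemma caratheodory_cone (A : set V) x : A !=set0 -> cone A x ->
  exists a nu, [/\ forall i : 'I_4, 0 <= a i, forall i : 'I_4, A (nu i) &
    x = \sum_i a i *: nu i].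
Proof.
move=> [nu0 Anu0]; elim => [|b mu z b0 Amu _ [a [nu [a0 Anu ->]]]].
  exists (fun=> 0), (fun=> nu0); split => //.
  by rewrite big1 // => i _; rewrite scale0r.
pose a' i := if unlift (ord0 : 'I_5) i is Some j then a j else b.
pose nu' i := if unlift (ord0 : 'I_5) i is Some j then nu j else mu.
have a'0 i : 0 <= a' i by rewrite /a'; case: unliftP.
have Anu' i : A (nu' i) by rewrite /nu'; case: unliftP.
have -> : b *: mu + \sum_i a i *: nu i = \sum_i a' i *: nu' i.
  rewrite [RHS]big_ord_recl /a' /nu' unlift_none; congr (_ + _).
  by apply: eq_bigr => i _; rewrite liftK.
have [i0 [c [c0 ->]]] := nonneg_combination_drop nu' a'0.
by exists c, (fun i => nu' (lift i0 i)).
Qed.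


(** * Continuity of q and compact boxes *)

Lemma entry_continuous (n k : nat) :
  continuous (fun x : 'cV[R]_n.+1 => entry x k).
Proof. by move=> x; exact: coord_continuous. Qed.

Lemma qform_continuous (T : topologicalType) (f h : T -> V) :
  continuous f -> continuous h -> continuous (fun t => qform (f t) (h t)).
Proof.
move=> cf ch t; rewrite /qform.
have ce (u : T -> V) k : continuous u -> {for t, continuous (fun s => entry (u s) k)}.
  move=> cu; apply: (@continuous_comp _ _ _ u (fun x : V => entry x k)).
    exact: cu.
  exact: entry_continuous.
by apply: cvgD; [apply: cvgD; [apply: cvgB; [apply: cvgN|]|]|]; apply: cvgM; exact: ce.
Qed.

Lemma trmx_continuous m n : continuous (@trmx R m n).
Proof.
move=> M s /nbhs_ballP[e e0 es]; apply/nbhs_ballP; exists e => // N [_ MN].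
by apply: es; split => // i j; rewrite !mxE; exact: MN.
Qed.

Lemma compact_cV_box n (a : R) :
  compact [set x : 'cV[R]_n | forall i, -a <= x i 0 <= a].
Proof.
pose B := [set v : 'rV[R]_n | forall i, v ord0 i \in `[-a, a]].
have cB : compact B.
  by apply: (@rV_compact _ _ (fun=> `[-a, a]%classic)) => _; exact: segment_compact.
have -> : [set x : 'cV[R]_n | forall i, -a <= x i 0 <= a] = (@trmx R 1 n) @` B.
  apply/seteqP; split => [x xa|_ [y yB <-] i]; last first.
    by have := yB i; rewrite !mxE in_itv.
  by exists (x^T); rewrite ?trmxK // => i; rewrite !mxE in_itv; exact: xa.
by apply: continuous_compact cB; apply: continuous_subspaceT; exact: trmx_continuous.
Qed.

(** * The torus and acausal circles *)

Definition torus : set V := [set nu |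
  entry nu 0 ^+ 2 + entry nu 1 ^+ 2 = 1 /\ entry nu 2 ^+ 2 + entry nu 3 ^+ 2 = 1].

Lemma circleE (z : 'cV[R]_2) :
  circle z <-> entry z 0 ^+ 2 + entry z 1 ^+ 2 = 1.
Proof.
rewrite /circle /= /enorm2; split => [h|->]; last exact: sqrtr1.
rewrite -[LHS]sqr_sqrtr ?h ?expr1n //.
by rewrite addr_ge0 // sqr_ge0.
Qed.

Lemma entry_col_mx (w z : 'cV[R]_2) :
  [/\ entry (col_mx w z : V) 0 = entry w 0, entry (col_mx w z : V) 1 = entry w 1,
      entry (col_mx w z : V) 2 = entry z 0 & entry (col_mx w z : V) 3 = entry z 1].
Proof.
rewrite /entry; split.
- by rewrite -(col_mxEu w z); congr (col_mx _ _ _ _); apply/val_inj; rewrite /= !inordK.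
- by rewrite -(col_mxEu w z); congr (col_mx _ _ _ _); apply/val_inj; rewrite /= !inordK.
- by rewrite -(col_mxEd w z); congr (col_mx _ _ _ _); apply/val_inj; rewrite /= !inordK.
- by rewrite -(col_mxEd w z); congr (col_mx _ _ _ _); apply/val_inj; rewrite /= !inordK.
Qed.

Lemma cV2_eqP (w z : 'cV[R]_2) :
  entry w 0 = entry z 0 -> entry w 1 = entry z 1 -> w = z.
Proof.
move=> h0 h1; apply/colP => -[[|[|//]] i2].
  by move: h0; rewrite /entry (_ : inord 0 = Ordinal i2) //; apply/val_inj; rewrite /= inordK.
by move: h1; rewrite /entry (_ : inord 1 = Ordinal i2) //; apply/val_inj; rewrite /= inordK.
Qed.

Lemma torus_qform0 nu : torus nu -> qform nu nu = 0.
Proof. by rewrite /torus /= /qform => -[h1 h2]; lra. Qed.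

Section AcausalCircle.
Variable L : set V.
Hypothesis hL : acausal_circle L.

Lemma acausal_torus : L `<=` torus.
Proof.
have [F [FC _ ->]] := hL => _ [z Cz <-]; rewrite /torus /=.
have [-> -> -> ->] := entry_col_mx (F z) z.
by split; apply/circleE => //; exact: FC.
Qed.

(** For nu = (F z, z) and mu = (F y, y) on the torus, 2 q(nu, mu) = |F z - F y|^2 - |z - y|^2, so
    the strict contraction property of F is exactly this sign. *)
Lemma acausal_qform_lt nu mu : L nu -> L mu -> nu <> mu -> qform nu mu < 0.
Proof.
have [F [FC Flt ->]] := hL => -[z Cz <-] [y Cy <-] zy.
have {}zy : z <> y by move=> e; apply: zy; rewrite e.
have := Flt _ _ Cz Cy zy; rewrite /enorm2 => lt1.
have := FC _ Cz; have := FC _ Cy; move: Cz Cy.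
move=> /circleE hz /circleE hy /circleE hFy /circleE hFz.
have {lt1} : entry (F z - F y) 0 ^+ 2 + entry (F z - F y) 1 ^+ 2 <
    entry (z - y) 0 ^+ 2 + entry (z - y) 1 ^+ 2.
  rewrite ltNge; apply: contraTN lt1 => h; rewrite -leNgt.
  exact: ler_wsqrtr.
rewrite /qform; have [-> -> -> ->] := entry_col_mx (F z) z.
have [-> -> -> ->] := entry_col_mx (F y) y.
have eB (u v : 'cV[R]_2) k : entry (u - v) k = entry u k - entry v k by rewrite /entry !mxE.
by rewrite !eB; nra.
Qed.

Lemma acausal_qform_le nu mu : L nu -> L mu -> qform nu mu <= 0.
Proof.
move=> Lnu Lmu; have [<-|/eqP ne] := eqVneq nu mu.
  by rewrite torus_qform0 //; exact: acausal_torus.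
by apply: ltW; exact: acausal_qform_lt.
Qed.

(* Acausality makes L a maximal achronal subset of the torus, which exhibits it
   as an intersection of closed sets. *)
Lemma acausal_maximal nu : torus nu -> (forall mu, L mu -> qform nu mu <= 0) -> L nu.
Proof.
have [F [FC _ LE]] := hL; rewrite -[nu](@vsubmxK _ 2 2 1).
set w := usubmx _; set z := dsubmx _.
rewrite /torus /=; have [-> -> -> ->] := entry_col_mx w z => -[hw hz] hmu.
have Cz : circle z by apply/circleE.
(* Testing nu = (w, z) against the point of L over the same z gives |w - F z|^2 = 2 q(nu, mu) <= 0,
   hence w = F z. *)
have := hmu (col_mx (F z) z); rewrite LE => /(_ (ex_intro2 _ _ z Cz erefl)).
have := FC _ Cz => /circleE hF.
rewrite /qform; have [-> -> -> ->] := entry_col_mx w z.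
have [-> -> -> ->] := entry_col_mx (F z) z => h.
have hs : (entry w 0 - entry (F z) 0) ^+ 2 + (entry w 1 - entry (F z) 1) ^+ 2 <= 0 by nra.
have h0 : (entry w 0 - entry (F z) 0) ^+ 2 = 0.
  by apply/eqP; rewrite eq_le sqr_ge0 andbT; apply: le_trans hs; rewrite lerDl sqr_ge0.
have h1 : (entry w 1 - entry (F z) 1) ^+ 2 = 0.
  by apply/eqP; rewrite eq_le sqr_ge0 andbT; apply: le_trans hs; rewrite lerDr sqr_ge0.
exists z => //; suff -> : F z = w by [].
apply: cV2_eqP; apply/esym/eqP; rewrite -subr_eq0 -sqrf_eq0.
  by rewrite h0.
by rewrite h1.
Qed.

(** By maximality L is cut out by closed conditions: the two torus equations and q(., mu) <= 0 for
    mu in L. The torus lies in the box of radius 1. *)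
Lemma acausal_compact : compact L.
Proof.
apply: (subclosed_compact _ (@compact_cV_box 4 1)).
  pose f i j (nu : V) : R := entry nu i * entry nu i + entry nu j * entry nu j.
  have -> : L = (f 0 1 @^-1` [set y | y = 1]) `&` (f 2 3 @^-1` [set y | y = 1]) `&`
      \bigcap_(mu in L) ((fun nu : V => qform nu mu) @^-1` [set y | y <= 0]).
    apply/seteqP; split=> [nu Lnu|nu [[t1 t2] Hnu]].
      have [t1 t2] := acausal_torus Lnu; split=> // mu Lmu.
      exact: acausal_qform_le.
    exact: acausal_maximal.
  have ce i j : continuous (f i j).
    have csq (T : topologicalType) (u v : T -> R) :
        continuous u -> continuous v -> continuous (fun t => u t * u t + v t * v t).
      by move=> cu cv t; apply: cvgD; apply: cvgM; [exact: cu|exact: cu|exact: cv|exact: cv].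
    by apply: csq; exact: entry_continuous.
  have cl i j : closed (f i j @^-1` [set y | y = 1]).
    by have /continuous_closedP := ce i j; apply; exact: closed_eq.
  apply: closedI; first by apply: closedI; exact: cl.
  apply: closed_bigI => mu _.
  have /continuous_closedP : continuous (fun nu : V => qform nu mu).
    apply: (@qform_continuous _ id (fun=> mu)) => x; [exact: cvg_id|exact: cst_continuous].
  by apply; exact: closed_le.
move=> nu /acausal_torus [h0 h1] i.
have sq_le1 (a b : R) : a ^+ 2 + b ^+ 2 = 1 -> -1 <= a <= 1 /\ -1 <= b <= 1.
  by move=> ab; split; apply/andP; split; nra.
have [[b0 b1] [b2 b3]] := (sq_le1 _ _ h0, sq_le1 _ _ h1).
rewrite -[i]inord_val; case: i => -[|[|[|[|//]]]] ? //=.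
Qed.

Lemma acausal_nonzero nu : L nu -> nu <> 0.
Proof.
move=> /acausal_torus [+ _] e; rewrite e /entry !mxE !expr0n /= addr0 => /eqP.
by rewrite eq_sym oner_eq0.
Qed.

(** Provides the base point y0 of C(L). The points nu, mu of L over the antipodal pair (1, 0), (-1,
    0) are isotropic, so q(nu + mu) = 2 q(nu, mu) < 0, and nu + mu can be normalized. *)
Lemma acausal_timelike : exists2 y, cone L y & qform y y = -1.
Proof.
have [F [FC _ LE]] := hL.
pose z : 'cV[R]_2 := \col_i (i == 0)%:R.
have z0 : entry z 0 = 1.
  by rewrite /entry mxE (_ : inord 0 = 0) //; apply/val_inj; rewrite /= inordK.
have z1 : entry z 1 = 0.
  by rewrite /entry mxE (_ : inord 1 = 1) //; apply/val_inj; rewrite /= inordK.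
have Cz : circle z by apply/circleE; rewrite z0 z1; lra.
have eN k : entry (- z) k = - entry z k by rewrite /entry !mxE.
have Cz' : circle (-z).
  by apply/circleE; rewrite !eN !sqrrN; apply/circleE.
have L1 : L (col_mx (F z) z) by rewrite LE; exists z.
have L2 : L (col_mx (F (-z)) (-z)) by rewrite LE; exists (-z).
set nu := col_mx _ _ in L1; set mu := col_mx _ _ in L2.
have q0 : qform nu mu < 0.
  apply: acausal_qform_lt => //; rewrite /nu /mu => e.
  have := congr1 (fun u : V => entry u 2) e.
  have [_ _ -> _] := entry_col_mx (F z) z; have [_ _ -> _] := entry_col_mx (F (-z)) (-z).
  by rewrite eN z0; lra.
have qs : qform (nu + mu) (nu + mu) = 2 * qform nu mu.
  rewrite !qformE !torus_qform0; [|exact: acausal_torus|exact: acausal_torus].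
  by rewrite (qformC mu nu); ring.
exists ((Num.sqrt (- (2 * qform nu mu)))^-1 *: (nu + mu)).
  by apply: cone_scale; [rewrite invr_ge0 sqrtr_ge0|apply: cone_add; exact: cone_gen].
rewrite !(qformZl, qformZr) qs mulrA -invfM -expr2 sqr_sqrtr; last by lra.
by rewrite invrN mulNr mulVf // mulf_neq0 ?pnatr_eq0 // lt_eqF.
Qed.

End AcausalCircle.


(** * Uniform negativity on the circle *)

Section NegativeOn.
Variable L : set V.

(** A quantitative form of the condition defining O_+(L), which is the case c = 0; a positive c is
    what yields bounds on coefficients. *)
Definition negative_on (c : R) (x : V) : Prop := forall nu, L nu -> qform x nu < - c.

(** A tube argument: the strict inequality is open jointly in the vector and in nu, and L is
    compact. *)
Lemma negative_on_open c : compact L -> open (negative_on c).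
Proof.
move=> /compact_near_coveringP cL; rewrite openE => w Nw.
apply: (cL V (nbhs w) (fun w' nu => qform w' nu < - c)) => nu Lnu.
have cq : continuous (fun z : V * V => qform z.2 z.1).
  by apply: (@qform_continuous _ snd fst) => z; [exact: cvg_snd|exact: cvg_fst].
have /open_nbhs_nbhs : open_nbhs (nu, w)
    ((fun z : V * V => qform z.2 z.1) @^-1` [set y | y < - c]).
  split; last exact: Nw.
  by move/continuousP : cq; apply; exact: open_lt.
by [].
Qed.

Lemma negative_on_uniform x : compact L -> negative_on 0 x ->
  exists2 c, 0 < c & negative_on c x.
Proof.
move=> cL Nx; have [L0|/set0P L0] := eqVneq L set0.
  by exists 1 => // nu; rewrite L0.
have cq : continuous (qform x).
  by apply: (@qform_continuous _ (fun=> x) id) => z; [exact: cst_continuous|exact: cvg_id].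
have [nu /set_mem Lnu numax] := compact_EVT_max L0 cL (continuous_subspaceT cq).
have := Nx _ Lnu; rewrite oppr0 => nu0.
(* Half the maximum of q(x, .) on L, so that the inequality remains strict. *)
exists (- (qform x nu / 2)); first by lra.
by move=> mu Lmu; have := numax _ (mem_set Lmu); lra.
Qed.

End NegativeOn.

(** * The geodesic flow and the set of points that meet O_+(L) *)

Section Flow.
Implicit Type p : V * V.

Lemma cosh_sinh (t : R) : cosh t ^+ 2 - sinh t ^+ 2 = 1.
Proof.
rewrite /cosh /sinh; have := expRxMexpNx_1 t.
by set a := expR t; set b := expR (- t) => ab; rewrite -[RHS]ab; field.
Qed.

Lemma coshN (t : R) : cosh (- t) = cosh t.
Proof. by rewrite /cosh opprK addrC. Qed.

Lemma sinhN (t : R) : sinh (- t) = - sinh t.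
Proof. by rewrite /sinh opprK; lra. Qed.

Lemma cosh_sinh_bound (t M : R) : `|t| <= M ->
  `|cosh t| <= expR M /\ `|sinh t| <= expR M.
Proof.
rewrite ler_norml => /andP[tM1 tM2].
have h1 : expR t <= expR M by rewrite ler_expR.
have h2 : expR (- t) <= expR M by rewrite ler_expR lerNl.
have := expR_gt0 t; have := expR_gt0 (- t).
by rewrite /cosh /sinh !ler_norml; split; apply/andP; split; lra.
Qed.

Lemma geod_flowK (t : R) p : geod_flow (- t) (geod_flow t p) = p.
Proof.
case: p => x v; rewrite /geod_flow /= coshN sinhN; congr pair.
  rewrite !scalerDr !scalerA addrACA -!scalerDl.
  rewrite (_ : cosh t * cosh t + - sinh t * sinh t = 1); last by have := cosh_sinh t; lra.
  by rewrite (_ : cosh t * sinh t + - sinh t * cosh t = 0) ?scale0r ?scale1r ?addr0 //; ring.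
rewrite !scalerDr !scalerA addrACA -!scalerDl.
rewrite (_ : - sinh t * sinh t + cosh t * cosh t = 1); last by have := cosh_sinh t; lra.
by rewrite (_ : - sinh t * cosh t + cosh t * sinh t = 0) ?scale0r ?scale1r ?add0r //; ring.
Qed.

Lemma geod_flow_T1AdS3 (t : R) p : T1AdS3 p -> T1AdS3 (geod_flow t p).
Proof.
case: p => x v [/= xx xv vv]; rewrite /T1AdS3 /=.
have := cosh_sinh t; set a := cosh t; set b := sinh t => ab.
by rewrite !qformE (qformC v x) xx xv vv; split; nra.
Qed.

Lemma geod_flow_act (t : R) (g : 'M[R]_4) p :
  geod_flow t (act_tan g p) = act_tan g (geod_flow t p).
Proof. by rewrite /geod_flow /act_tan /= !mulmxDr !scalemxAr. Qed.

Lemma geod_flow_continuous (t : R) : continuous (fun p => (geod_flow t p).1).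
Proof.
have clin (T : topologicalType) (f h : T -> V) a b : continuous f -> continuous h ->
    continuous (fun s => a *: f s + b *: h s).
  by move=> cf ch s; apply: cvgD; apply: cvgZr; [exact: cf|exact: ch].
by apply: (clin _ fst snd) => p; [exact: cvg_fst|exact: cvg_snd].
Qed.

(** The flow preserves the unit tangent bundle, so the base point stays in AdS_3 and only the sign
    condition on L remains. *)
Lemma MtildeP (L : set V) p :
  Mtilde L p <-> T1AdS3 p /\ exists t, negative_on L 0 (geod_flow t p).1.
Proof.
split=> -[T1p [t ht]]; split=> //; exists t.
  by move=> nu Lnu; rewrite oppr0; apply: ht.2.
split; first by have [] := geod_flow_T1AdS3 t T1p.
by move=> nu /ht; rewrite oppr0.
Qed.

Lemma Mtilde_bigcup (L : set V) :
  Mtilde L = \bigcup_(t in setT) (geod_flow t @` T1O_plus L).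
Proof.
apply/seteqP; split=> [p [T1p [t Ot]]|_ [t _ [p [T1p Op] <-]]].
  exists (- t) => //; exists (geod_flow t p); last exact: geod_flowK.
  by split=> //; exact: geod_flow_T1AdS3.
split; first exact: geod_flow_T1AdS3.
by exists (- t); rewrite geod_flowK.
Qed.

Lemma Mtilde_open (L : set V) : compact L ->
  @open (subspace (@T1AdS3 R)) (Mtilde L).
Proof.
move=> cL; apply/open_subspaceP.
exists (\bigcup_(t in setT) ((fun p => (geod_flow t p).1) @^-1` negative_on L 0)).
  apply: bigcup_open => t _.
  by have /continuousP := @geod_flow_continuous t; apply; exact: negative_on_open.
apply/seteqP; split=> p.
  by move=> [[t _ Nt] T1p]; split=> //; apply/MtildeP; split=> //; exists t.
by move=> [/MtildeP[T1p [t Nt]] _]; split=> //; exists t.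
Qed.

(** A time good for p, with some margin c, stays good with the same margin near p; compactness of K
    makes the choices uniform. A single M bounds the times, and its inverse is the margin. *)
Lemma compact_Mtilde_time (L : set V) (K : set (V * V)) : compact L ->
  compact K -> K `<=` Mtilde L ->
  exists2 M : R, 0 < M &
    forall p, K p -> exists2 t, `|t| <= M & negative_on L M^-1 (geod_flow t p).1.
Proof.
move=> cL /compact_near_coveringP cK KM.
pose P M p := exists2 t, `|t| <= M & negative_on L M^-1 (geod_flow t p).1.
have : \forall M \near +oo, K `<=` P M.
  (* Near-covering compactness along M -> +oo: it suffices to treat points near p and large M
     together, where M >= |t| and M >= 1/c are enough. *)
  apply: (cK R +oo P) => p /KM /MtildeP[_ [t]].
  move=> /(negative_on_uniform cL)[c c0 Nc].
  have nU : \forall p' \near p, negative_on L c (geod_flow t p').1.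
    apply: (@geod_flow_continuous t p).
    by apply: open_nbhs_nbhs; split=> //; exact: negative_on_open.
  near=> p' M => /=; exists t; first by near: M; apply: nbhs_pinfty_ge; rewrite num_real.
  have : negative_on L c (geod_flow t p').1 by near: p'.
  move=> h nu Lnu; apply: (lt_le_trans (h nu Lnu)); rewrite lerN2.
  have cM : c^-1 <= M by near: M; apply: nbhs_pinfty_ge; rewrite num_real.
  by rewrite -[c]invrK lef_pV2 // posrE ?invr_gt0 // (lt_le_trans _ cM) // invr_gt0.
move=> H; near (pinfty_nbhs R) => M; exists M.
  by near: M; apply: nbhs_pinfty_gt; rewrite num_real.
by move: (near H M) => h p Kp; apply: (h _ p Kp).
Unshelve. all: by end_near.
Qed.

End Flow.

(** * The action of a quasi-Fuchsian group on the cone and on [Mtilde L] *)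

Section QuasiFuchsian.
Variables (G : set 'M[R]_4) (L : set V).
Hypothesis hG : quasi_fuchsian G L.

Let hL : acausal_circle L. Proof. by case: hG. Qed.
Let cL : compact L. Proof. exact: acausal_compact. Qed.

Lemma qf_SO22 g : G g -> SO22 g.
Proof. by have [[GS _ _ _] _ _ _] := hG; move=> /GS; exact: connected_component_sub. Qed.

Lemma qf_qform g x y : G g -> qform (g *m x) (g *m y) = qform x y.
Proof. by move=> /qf_SO22[_]; apply. Qed.

Lemma qf_unit g : G g -> g \in unitmx.
Proof. by move=> /qf_SO22[dg _]; rewrite unitmxE dg unitr1. Qed.

Lemma qf_inv g : G g -> G (invmx g).
Proof. by have [[_ _ _ GV] _ _ _] := hG; exact: GV. Qed.

Lemma qf_exp g n : G g -> G (g ^+ n).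
Proof.
have [[_ G1 GM _] _ _ _] := hG; move=> Gg; elim: n => [|n IH]; first exact: G1.
by rewrite exprS; exact: GM.
Qed.

(** Lifts invariance of L from the boundary to linear vectors, where it holds up to the positive
    factor removed by [to_torus]. *)
Lemma qf_bd g nu : G g -> L nu -> exists s mu, [/\ 0 < s, L mu & g *m nu = s *: mu].
Proof.
move=> Gg Lnu; have [_ _ /(_ g Gg) gL _] := hG.
have : L (bd_act g nu) by rewrite -gL; exists nu.
rewrite /bd_act /to_torus; set r := Num.sqrt _ => Lmu.
exists r, (r^-1 *: (g *m nu)).
have r0 : r != 0.
  (* As 0^-1 = 0, a zero factor would send nu to the zero vector, which is not in L. *)
  by apply/eqP => r0; apply: (acausal_nonzero hL Lmu); rewrite r0 invr0 scale0r.
by split=> //; [rewrite lt_neqAle eq_sym r0 sqrtr_ge0|rewrite scalerA divff // scale1r].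
Qed.

Lemma qf_cone g x : G g -> cone L x -> cone L (g *m x).
Proof.
move=> Gg; elim=> [|a nu y a0 Lnu _ IH]; first by rewrite mulmx0; exact: cone_nil.
have [s [mu [s0 Lmu gnu]]] := qf_bd Gg Lnu.
rewrite mulmxDr -scalemxAr gnu scalerA; apply: cone_cons => //.
by rewrite mulr_ge0 // ltW.
Qed.

(** q(g x, nu) = q(x, g^-1 nu), and g^-1 nu is a positive multiple of a point of L. That multiple is
    not controlled, so the statement is for margin 0. *)
Lemma qf_negative g x : G g -> negative_on L 0 x -> negative_on L 0 (g *m x).
Proof.
move=> Gg Nx nu Lnu; have [s [mu [s0 Lmu gnu]]] := qf_bd (qf_inv Gg) Lnu.
rewrite -[nu](mulKVmx (qf_unit Gg)) qf_qform // gnu qformZr oppr0.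
by rewrite pmulr_rlt0 //; have := Nx _ Lmu; rewrite oppr0.
Qed.

Lemma qf_T1AdS3 g p : G g -> T1AdS3 p -> T1AdS3 (act_tan g p).
Proof. by move=> Gg [h1 h2 h3]; split; rewrite /= qf_qform. Qed.

Lemma qf_Mtilde g p : G g -> Mtilde L p -> Mtilde L (act_tan g p).
Proof.
move=> Gg /MtildeP[T1p [t Nt]]; apply/MtildeP; split; first exact: qf_T1AdS3.
by exists t; rewrite geod_flow_act; exact: qf_negative.
Qed.

Lemma qf_preserved : preserved (@act_tan R) G (Mtilde L).
Proof.
move=> g Gg; apply/seteqP; split=> [_ [p Mp <-]|p Mp]; first exact: qf_Mtilde.
exists (act_tan (invmx g) p); first by apply: qf_Mtilde => //; exact: qf_inv.
by case: p {Mp} => x v; rewrite /act_tan /= !mulKVmx // qf_unit.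
Qed.

Lemma cone_qform_le2 x y : cone L x -> cone L y -> qform x y <= 0.
Proof.
move=> cx cy; apply: cone_qform_le cy => nu Lnu; rewrite qformC.
by apply: cone_qform_le cx => mu Lmu; exact: (acausal_qform_le hL).
Qed.

(** * Compact pieces of the cone and proper discontinuity *)

Definition truncated_cone (M : R) : set V :=
  [set x | exists a nu, [/\ forall i : 'I_4, 0 <= a i <= M,
    forall i : 'I_4, L (nu i) & x = \sum_i a i *: nu i]].

(** With the number of terms fixed at four, the set is (A + A) + (A + A), where A is the image of
    the compact set [0, M] x L under scaling. *)
Lemma truncated_cone_compact M : compact (truncated_cone M).
Proof.
pose A := (fun z : R * V => z.1 *: z.2) @` (`[0, M]%classic `*` L).
have cA : compact A.
  have cI : compact (`[0, M]%classic : set R) by exact: segment_compact.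
  apply: continuous_compact; last exact: (compact_setX cI cL).
  by apply: continuous_subspaceT; exact: scale_continuous.
have cS (B C : set V) : compact B -> compact C ->
    compact ((fun z : V * V => z.1 + z.2) @` (B `*` C)).
  move=> cB cC; apply: continuous_compact; last exact: compact_setX.
  by apply: continuous_subspaceT; exact: add_continuous.
have -> : truncated_cone M = (fun z : V * V => z.1 + z.2) @`
    (((fun z : V * V => z.1 + z.2) @` (A `*` A)) `*`
     ((fun z : V * V => z.1 + z.2) @` (A `*` A))).
  have AP a nu : 0 <= a <= M -> L nu -> A (a *: nu).
    by move=> ha Lnu; exists (a, nu) => //; split=> //=; rewrite in_itv.
  apply/seteqP.
  split=> [x [a [nu [ha Lnu ->]]]|_ [[_ _] [[[_ _] [[z0 Z0 <-] [z1 Z1 <-]] <-]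
      [[_ _] [[z2 Z2 <-] [z3 Z3 <-]] <-]] <-]].
    rewrite !big_ord_recr big_ord0 /= add0r -addrA.
    exists (a (inord 0) *: nu (inord 0) + a (inord 1) *: nu (inord 1),
            a (inord 2) *: nu (inord 2) + a (inord 3) *: nu (inord 3)).
      split; [exists (a (inord 0) *: nu (inord 0), a (inord 1) *: nu (inord 1))|
              exists (a (inord 2) *: nu (inord 2), a (inord 3) *: nu (inord 3))] => //=;
        by split; apply: AP.
    rewrite /=; congr (_ + _ + (_ + _)); congr (a _ *: nu _);
      by apply/val_inj; rewrite /= inordK.
  exists (fun i : 'I_4 => nth 0 [:: z0.1; z1.1; z2.1; z3.1] i),
    (fun i : 'I_4 => nth 0 [:: z0.2; z1.2; z2.2; z3.2] i).
  move: Z0 Z1 Z2 Z3; rewrite /= !in_itv => -[h0 l0] [h1 l1] [h2 l2] [h3 l3].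
  split; [by case=> -[|[|[|[|//]]]]|by case=> -[|[|[|[|//]]]]|].
  by rewrite !big_ord_recr big_ord0 /= add0r -addrA.
exact: (cS _ _ (cS _ _ cA cA) (cS _ _ cA cA)).
Qed.

(** Transfers proper discontinuity from C(L): writing g y0 = sum a_i nu_i, the bounds - c2 <= q(g u,
    g y0) and q(g u, nu_i) < - c1 force a_i <= c2 / c1. *)
Lemma core_orbit_finite (y0 : V) (c1 c2 : R) : 0 < c1 -> convex_core L y0 ->
  finite_set [set g | G g /\ exists u, - c2 <= qform u y0 /\ negative_on L c1 (g *m u)].
Proof.
move=> c10 Cy0; have [cy0 qy0] := (convex_coreP _ _).1 Cy0.
have [_ _ _ [_ PD _]] := hG.
(* Adjoining y0 makes g K meet K at g y0 as soon as g y0 lies in the truncated cone. *)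
pose K := (truncated_cone (c2 / c1) `&` [set y | qform y y = -1]) `|` [set y0].
have cK : compact K.
  apply: compactU; last exact: compact_set1.
  apply: compact_closedI; first exact: truncated_cone_compact.
  have /continuous_closedP : continuous (fun y : V => qform y y).
    by apply: (@qform_continuous _ id id) => x; exact: cvg_id.
  by move=> /(_ [set r | r = -1]); apply; exact: closed_eq.
have L0 : L !=set0.
  apply/set0P/eqP => L0; move: qy0; case: cy0 => [|a nu x _]; rewrite ?L0 //.
  by rewrite qform0l => /eqP; rewrite eq_sym oppr_eq0 oner_eq0.
have KC : K `<=` convex_core L.
  move=> y [[[a [nu [ha Lnu ->]]] qy]|-> //]; apply/convex_coreP; split=> //.
  apply: cone_sum => i; apply: cone_scale; last exact: cone_gen.
  by case/andP: (ha i).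
apply: sub_finite_set (PD K KC cK) => g [Gg [u [uy0 Ngu]]]; split=> //.
exists (g *m y0); split; first by exists y0 => //; right.
left; split; last by rewrite /= qf_qform.
have [a [nu [a0 Lnu gy0]]] := caratheodory_cone L0 (qf_cone Gg cy0).
exists a, nu; split=> // i; rewrite a0 ler_pdivlMr //=.
have : - c2 <= \sum_j a j * qform (g *m u) (nu j).
  rewrite -(qf_qform _ _ Gg) gy0 in uy0; apply: le_trans uy0 _.
  have qsum (r : seq 'I_4) : qform (g *m u) (\sum_(j <- r) a j *: nu j) =
      \sum_(j <- r) a j * qform (g *m u) (nu j).
    by elim/big_rec2 : _ => [|j x z _ IH]; rewrite ?qform0r // !qformE IH.
  by rewrite qsum.
(* All terms are nonpositive, so the i-th one alone is already at least - c2. *)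
rewrite (bigD1 i) //= => h.
have : \sum_(j < 4 | j != i) a j * qform (g *m u) (nu j) <= 0.
  apply: sumr_le0 => j _; apply: mulr_ge0_le0 => //.
  by have := Ngu _ (Lnu j); lra.
have : a i * c1 <= a i * (- qform (g *m u) (nu i)).
  by apply: ler_wpM2l => //; have := Ngu _ (Lnu i); lra.
by lra.
Qed.

Lemma compact_qform_bound (K : set (V * V)) (y0 : V) : compact K ->
  exists B, forall p, K p -> `|qform p.1 y0| <= B /\ `|qform p.2 y0| <= B.
Proof.
move=> cK.
have bnd (f : V * V -> V) : continuous f -> exists B, forall p, K p -> `|qform (f p) y0| <= B.
  move=> cf; have cq : continuous (fun p => qform (f p) y0).
    by apply: (@qform_continuous _ f (fun=> y0)) => // x; exact: cst_continuous.
  have [B [_ HB]] := compact_bounded (continuous_compact (continuous_subspaceT cq) cK).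
  by exists (B + 1) => p Kp; apply: (HB (B + 1)); [lra|exists p].
have [|B1 h1] := bnd fst; first by move=> x; exact: cvg_fst.
have [|B2 h2] := bnd snd; first by move=> x; exact: cvg_snd.
exists (Num.max B1 B2) => p Kp; rewrite !le_max h1 // h2 // orbT; split=> //.
Qed.

Lemma qf_properly_discontinuous :
  acts_properly_discontinuously (@act_tan R) G (Mtilde L).
Proof.
move=> K KM cK; have [y0 cy0 qy0] := acausal_timelike hL.
have Cy0 : convex_core L y0 by apply/convex_coreP.
have [M M0 HM] := compact_Mtilde_time cL cK KM.
have [B HB] := compact_qform_bound y0 cK.
have Mi : 0 < M^-1 by rewrite invr_gt0.
(* Expanding both flows, q(u, y0) has four terms, each of absolute value at most e^M B. *)
apply: sub_finite_set (core_orbit_finite (4 * (expR M * B)) Mi Cy0) => g.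
move=> [Gg [_ [[p Kp <-] Kgp]]]; split=> //.
have [s sM Ns] := HM _ Kp; have [t tM Nt] := HM _ Kgp.
have bound r : `|r| <= M -> - (2 * (expR M * B)) <= qform (geod_flow r p).1 y0.
  move=> /cosh_sinh_bound[hc hs]; have [h1 h2] := HB _ Kp.
  rewrite !qformE.
  have b1 : `|cosh r * qform p.1 y0| <= expR M * B by rewrite normrM ler_pM.
  have b2 : `|sinh r * qform p.2 y0| <= expR M * B by rewrite normrM ler_pM.
  by move: b1 b2; rewrite !ler_norml => /andP[? _] /andP[? _]; lra.
exists ((geod_flow s p).1 + (geod_flow t p).1); split.
  by rewrite qformDl; have := bound _ sM; have := bound _ tM; lra.
move=> nu Lnu; rewrite mulmxDr qformDl.
(* The time t, chosen for g p, contributes the margin 1/M; the time s, chosen for p, contributes a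
   negative value by invariance. *)
have := Nt nu Lnu; rewrite geod_flow_act /=.
have Ns0 : negative_on L 0 (geod_flow s p).1.
  by move=> mu Lmu; have := Ns mu Lmu; rewrite oppr0; lra.
have := qf_negative Gg Ns0 Lnu; rewrite oppr0 /=; lra.
Qed.

(** * Freeness *)

Lemma qf_free : acts_freely (@act_tan R) G (Mtilde L).
Proof.
move=> g p Gg Mp gp.
have gnp n : act_tan (g ^+ n) p = p.
  elim: n => [|n IH]; first by case: (p) => x v; rewrite /act_tan expr0 !mul1mx.
  rewrite exprS -[RHS]gp -[in RHS]IH /act_tan /=.
  by rewrite !mulmxA.
have pM : [set p] `<=` Mtilde L by move=> _ ->.
(* All powers of g fix p, so proper discontinuity for the one-point set {p} leaves only finitely
   many of them. *)
have fin := qf_properly_discontinuous pM (@compact_set1 _ p).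
have [n gn] : exists n, g ^+ n.+1 = 1.
  have [[i [k ik]]|inj] := pselect (exists i k, g ^+ i = g ^+ (i + k.+1)).
    exists k; have gi : g ^+ i \is a GRing.unit by apply: unitrX; exact: (qf_unit Gg).
    by apply: (mulrI gi); rewrite -exprD -ik mulr1.
  have ginj : injective (fun n => g ^+ n).
    move=> i j ij; case: (ltngtP i j) => // lt; exfalso; apply: inj.
      by exists i, (j - i).-1; rewrite prednK ?subn_gt0 // subnKC // ltnW.
    by exists j, (i - j).-1; rewrite prednK ?subn_gt0 // subnKC // ltnW.
  have : finite_set [set: nat].
    apply: sub_finite_set (finite_preimage _ fin); last first.
      by move=> i j _ _; exact: ginj.
    move=> i _; split; first exact: qf_exp.
    by exists p; split=> //; exists p.
  by move/infinite_nat.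
have [y0 cy0 qy0] := acausal_timelike hL.
pose y := \sum_(j < n.+1) (g ^+ j *m y0).
have cy j : cone L (g ^+ j *m y0) by apply: qf_cone => //; exact: qf_exp.
have gy : g *m y = y.
  rewrite /y mulmx_sumr.
  (* Multiplication by g shifts the powers cyclically: the last term becomes g^(n+1) y0 = y0, the
     first term of the sum. *)
  rewrite [RHS]big_ord_recl [LHS]big_ord_recr /= addrC; congr (_ + _).
    by rewrite mulmxA -[g *m _]exprS gn expr0.
  by apply: eq_bigr => j _; rewrite mulmxA -[g *m _]exprS.
have qy : qform y y < 0.
  (* Splitting off y0 gives q(y) = -1 + 2 q(y0, z) + q(z), and q <= 0 between vectors of the
     cone. *)
  rewrite /y big_ord_recl /= expr0 mul1mx; set z := \sum_(j < n) _.
  have cz : cone L z by apply: cone_sum => j; exact: cy.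
  rewrite !qformE qy0 (qformC z).
  have := cone_qform_le2 cy0 cz; have := cone_qform_le2 cz cz; lra.
have [_ _ _ [free _ _]] := hG.
apply: (free g ((Num.sqrt (- qform y y))^-1 *: y) Gg); last by rewrite /act_pt -scalemxAr gy.
apply/convex_coreP; split.
  by apply: cone_scale; [rewrite invr_ge0 sqrtr_ge0|apply: cone_sum => j; exact: cy].
rewrite qformZl qformZr mulrA -invfM -expr2 sqr_sqrtr; last by lra.
by rewrite invrN mulNr mulVf // lt_eqF.
Qed.

End QuasiFuchsian.
End QForm.

Theorem proposition4p10 (R : realType) (G : set 'M[R]_4) (L : set 'cV[R]_4)
  (hG : quasi_fuchsian G L) :
  [/\ Mtilde L = (\bigcup_(t in setT) (geod_flow t @` T1O_plus L))%classic,
      @open (subspace (@T1AdS3 R)) (Mtilde L),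
      preserved (@act_tan R) G (Mtilde L),
      acts_freely (@act_tan R) G (Mtilde L) &
      acts_properly_discontinuously (@act_tan R) G (Mtilde L)].
Proof.
split.
- exact: Mtilde_bigcup.
- by apply: Mtilde_open; apply: acausal_compact; case: hG.
- exact: qf_preserved.
- exact: qf_free.
- exact: qf_properly_discontinuous.
Qed.
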